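(* Let $(a_n)$ be a positive monotonic sequence and $a(x)$ a positive continuous monotonic function threaded through it, i.e. $a(n)=a_n$ at integers $n$. Then, after realizing infinitesimals as $0$ and infinities as $\infty$, $$\sum a_{n}|_{n=\infty} = \int^{n} a(x)\,dx|_{n=\infty}.$$ That is, sum and integral at infinity may be interchanged in both directions: they are both $0$ (both converge) or both $\infty$ (both diverge).
   Context: Working in an ordered number system ${*G}$ extending $\mathbb{R}$ with infinitesimals $\Phi$ and infinities $\Phi^{-1}$ (comparable with the hyperreals), $\sum a_n|_{n=\infty}$ and $\int^{n} a(x)\,dx|_{n=\infty}$ denote the sum, respectively integral, evaluated at a point at infinity. Under the paper's criterion this evaluation is an infinitesimal exactly when the series (integral) converges; otherwise the series (integral) diverges. Under the transfer $\Phi\mapsto 0$, $\Phi^{-1}\mapsto\infty$, $\sum a_n|_{n=\infty}=0$ states that the sum converges and $\sum a_n|_{n=\infty}=\infty$ states that it diverges; likewise for integrals. An equality between two such expressions means that both are $0$ or both are $\infty$. *)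

(* Defs.v *)
From HB Require Import structures.
From mathcomp Require Import all_boot all_order all_algebra.
From mathcomp Require Import all_classical all_reals all_analysis.
Import Order.TTheory GRing.Theory Num.Theory.
Import numFieldNormedType.Exports.

Set Implicit Arguments.
Unset Strict Implicit.
Unset Printing Implicit Defensive.

Local Open Scope classical_set_scope.
Local Open Scope ring_scope.

(* An ordered field *G together with a point at infinity: [at_infty u] is the
   sequence u evaluated at n = oo, written u(n)|_{n=oo}. Evaluation commutes
   with the field operations and turns an inequality that holds eventually into
   an inequality in *G. The prime example is the field of hyperreals
   R^nat / U for a free ultrafilter U, where [at_infty u] is the class of u, or
   more generally the class of u \o w for w : nat -> nat tending to infinity. *)
Record infinity_field (R : realType) := InfinityField {
  infinity_carrier :> realFieldType ;
  at_infty : {rmorphism (nat -> R) -> infinity_carrier} ;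
  at_infty_le : forall u v : nat -> R,
    (\forall n \near \oo, u n <= v n) -> at_infty u <= at_infty v }.

Section InfinityField.
Context {R : realType} (G : infinity_field R).

(* The embedding of R in *G. *)
Definition standard (r : R) : G := at_infty G (fun=> r).

(* Note that 0 counts as an infinitesimal. *)
Definition infinitesimal (g : G) : Prop :=
  forall e : R, 0 < e -> `|g| < standard e.

Definition infinite (g : G) : Prop := forall M : R, standard M < `|g|.

(* The unique real at infinitesimal distance from g, when g is not infinite. *)
Definition standard_part (g : G) : R :=
  xget 0 [set r : R | infinitesimal (g - standard r)].

(* The transfer from *G to the extended reals, with Phi |-> 0 and
   Phi^-1 |-> oo. *)
Definition realize (g : G) : \bar R :=
  if `[< infinitesimal g >] then 0%E
  else if `[< infinite g >] then (if 0 < g then +oo%E else -oo%E)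
  else (standard_part g)%:E.

(* Value at n = oo of an indefinite sum or integral, where F is any of its
   determinations, i.e. F is known up to an additive real constant only. That
   constant is discarded: it is chosen so that a value which is not infinite
   has standard part 0 (an infinite value is not affected by the choice, after
   realization). *)
Definition indefinite_at_infty (F : nat -> R) : G :=
  if `[< infinite (at_infty G F) >] then at_infty G F
  else at_infty G F - standard (standard_part (at_infty G F)).

End InfinityField.

Section SumIntegral.
Context {R : realType}.

Definition partial_sum (n0 : nat) (a : nat -> R) (n : nat) : R :=
  \sum_(n0 <= k < n.+1) a k.

Definition partial_integral (n0 : nat) (f : R -> R) (x : R) : R :=
  \int[lebesgue_measure]_(t in `[n0%:R, x]) f t.

Definition sum_at_infty (G : infinity_field R) (n0 : nat) (a : nat -> R) : G :=
  indefinite_at_infty G (partial_sum n0 a).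

Definition integral_at_infty (G : infinity_field R) (n0 : nat) (f : R -> R) : G :=
  indefinite_at_infty G (fun n => partial_integral n0 f n%:R).

Definition sum_converges (n0 : nat) (a : nat -> R) : Prop :=
  cvg (partial_sum n0 a n @[n --> \oo]).

Definition integral_converges (n0 : nat) (f : R -> R) : Prop :=
  cvg (partial_integral n0 f x @[x --> +oo]).

End SumIntegral.

(* Main.v *)
(** Both partial sums and partial integrals are nondecreasing, so each either
   converges or tends to infinity; comparing the integral of [f] over
   [[n, n+1]] with [a n] and [a n.+1] shows that they do so together. Evaluation
   at infinity preserves eventual inequalities, hence sends a convergent sequence
   infinitely close to its limit and a sequence tending to [+oo] above every
   standard real. *)
Require Import Defs.
From HB Require Import structures.
From mathcomp Require Import all_boot all_order all_algebra.
From mathcomp Require Import unstable all_classical all_reals all_analysis lra.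
Import Order.TTheory GRing.Theory Num.Theory.
Import numFieldNormedType.Exports.
Local Open Scope classical_set_scope.
Local Open Scope ring_scope.

(** * Evaluation at infinity of convergent and divergent sequences *)

Section PointAtInfinity.
Context {R : realType} (G : infinity_field R).
Implicit Types (r s : R) (F : nat -> R) (g h : G).

(** With the next fact, this makes [standard] a ring morphism between fields, so that the [rmorph]
    lemmas and injectivity apply to it. *)
Fact standard_is_zmod_morphism : zmod_morphism (standard G).
Proof. by move=> r s; rewrite /standard -rmorphB. Qed.

Fact standard_is_monoid_morphism : monoid_morphism (standard G).
Proof.
split; first exact: rmorph1 (at_infty G).
by move=> r s; rewrite /standard -rmorphM.
Qed.

HB.instance Definition _ :=
  GRing.isZmodMorphism.Build R G (standard G) standard_is_zmod_morphism.
HB.instance Definition _ :=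
  GRing.isMonoidMorphism.Build R G (standard G) standard_is_monoid_morphism.

(** Evaluation preserves only weak inequalities; strictness is recovered from injectivity. *)
Lemma standard_lt r s : r < s -> standard G r < standard G s.
Proof.
move=> rs; rewrite lt_neqAle; apply/andP; split.
  by rewrite (inj_eq (fmorph_inj _)) lt_eqF.
apply: at_infty_le; apply: nearW => _; exact: ltW.
Qed.

Lemma standard_norm r : `|standard G r| = standard G `|r|.
Proof.
have [r0|r0|->] := ltgtP r 0; last by rewrite !(rmorph0, normr0).
- by have := standard_lt _ _ r0; rewrite rmorph0 => sr0;
  rewrite !ltr0_norm// rmorphN.
- by have := standard_lt _ _ r0; rewrite rmorph0 => sr0; rewrite !gtr0_norm.
Qed.

Lemma infinitesimalB g h :
  infinitesimal g -> infinitesimal h -> infinitesimal (g - h).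
Proof.
move=> gi hi e e0; apply: (le_lt_trans (ler_normB _ _)).
by rewrite [e]splitr rmorphD ltrD// ?gi ?hi ?divr_gt0.
Qed.

Lemma infinitesimal_standard r : infinitesimal (standard G r) -> r = 0.
Proof.
move=> ri; apply/eqP/negPn/negP => r0.
by have := ri `|r|; rewrite normr_gt0 standard_norm ltxx => /(_ r0).
Qed.

(** Two candidates differ by a standard real that is infinitesimal, hence zero. *)
Lemma standard_part_eq g r :
  infinitesimal (g - standard G r) -> standard_part g = r.
Proof.
move=> gr; apply: xget_unique => // s gs.
apply/eqP; rewrite -subr_eq0; apply/eqP/infinitesimal_standard.
have -> : standard G (s - r) = (g - standard G r) - (g - standard G s).
  by rewrite rmorphB opprB [RHS]addrC addrA subrK.
exact: infinitesimalB.
Qed.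

Lemma infinitesimal_not_infinite g r :
  infinitesimal (g - standard G r) -> ~ infinite g.
Proof.
move=> gr /(_ (1 + `|r|)); rewrite rmorphD rmorph1 /= -standard_norm => g_gt.
have := gr 1 ltr01; rewrite rmorph1; apply/negP; rewrite -leNgt.
apply: le_trans (lerB_dist _ _); rewrite lerBrDr; exact: ltW.
Qed.

Lemma at_infty_cvg F l :
  F n @[n --> \oo] --> l -> infinitesimal (at_infty G F - standard G l).
Proof.
(* Evaluation yields only a weak bound, so the distance to [l] is bounded by [e / 2] to stay
   strictly below [e]. *)
move=> Fl e e0; apply: (@le_lt_trans _ _ (standard G (e / 2))); last first.
  by apply: standard_lt; rewrite ltr_pdivrMr// ltr_pMr// ltr1n.
have near_l : \forall n \near \oo, `|F n - l| <= e / 2.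
  by move/cvgrPdistC_le : Fl; apply; rewrite divr_gt0.
rewrite /standard -rmorphB ler_norml -rmorphN.
by apply/andP; split; apply: at_infty_le; apply: filterS near_l => n;
  rewrite ler_norml => /andP[].
Qed.

(** The constant discarded by [indefinite_at_infty] is the limit of [F], and what remains is
    infinitesimal. *)
Lemma realize_cvg F : cvgn F -> realize (indefinite_at_infty G F) = 0%E.
Proof.
move=> /at_infty_cvg Fl.
rewrite /indefinite_at_infty asboolF; last exact: infinitesimal_not_infinite Fl.
by rewrite (standard_part_eq _ _ Fl) /realize asboolT.
Qed.

Lemma realize_dvg F :
  F n @[n --> \oo] --> +oo -> realize (indefinite_at_infty G F) = +oo%E.
Proof.
move=> /cvgryPge Foo.
have F_gt M : standard G M < at_infty G F.
  (* The margin [1] again turns a weak bound into a strict one. *)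
  apply: (@lt_le_trans _ _ (standard G (M + 1))).
    by rewrite standard_lt// ltrDl.
  exact: at_infty_le.
have Finf : infinite (at_infty G F).
  by move=> M; apply: lt_le_trans (F_gt M) (ler_norm _).
rewrite /indefinite_at_infty asboolT// /realize asboolF ?asboolT//; last first.
  by move=> /(_ 1 ltr01)/lt_trans/(_ (Finf 1)); rewrite ltxx.
by rewrite -(rmorph0 (standard G)) F_gt.
Qed.

End PointAtInfinity.

(** * Partial sums *)

Section PartialSum.
Context {R : realType} (n0 : nat) (a : nat -> R).

Lemma partial_sum_nondecreasing :
  (forall n, (n0 <= n)%N -> 0 <= a n) ->
  {homo partial_sum n0 a : m n / (m <= n)%N >-> m <= n}.
Proof.
move=> a_ge0; apply: homo_leq => [//|? ? ?|n]; first exact: le_trans.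
rewrite /partial_sum; have [n0n|n0n] := leqP n0 n.+1.
  by rewrite [leRHS]big_nat_recr//= lerDl a_ge0.
by rewrite !big_geq// ltnW.
Qed.

Lemma partial_sumS n : (n0 <= n)%N ->
  partial_sum n0 a n.+1 = partial_sum n0 a n + a n.+1.
Proof. by move=> n0n; rewrite /partial_sum big_nat_recr//= leqW. Qed.

Lemma partial_sum_first : partial_sum n0 a n0 = a n0.
Proof. by rewrite /partial_sum big_nat1. Qed.

End PartialSum.

(** * Partial integrals *)

Section PartialIntegral.
Context {R : realType} (n0 : nat) (f : R -> R).
Hypothesis f_cont : {within `[n0%:R, +oo[, continuous f}.

Lemma integrable_from (x y : R) : n0%:R <= x ->
  lebesgue_measure.-integrable `[x, y] (EFin \o f).
Proof.
move=> n0x; apply: continuous_compact_integrable; first exact: segment_compact.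
apply: continuous_subspaceW f_cont.
by move=> t /=; rewrite !in_itv/= andbT => /andP[/(le_trans n0x)].
Qed.

Lemma partial_integralB (x y : R) : n0%:R <= x -> x <= y ->
  partial_integral n0 f y - partial_integral n0 f x =
  \int[lebesgue_measure]_(t in `[x, y]) f t.
Proof.
move=> n0x xy; rewrite /partial_integral Rintegral_itvB//.
(* The difference is an integral over an interval open at [x]; adding that endpoint changes
   nothing. *)
- rewrite Rintegral_itv_obnd_cbnd//.
  apply: integrableS (integrable_from _ y n0x) => //.
  by apply: subset_itv; rewrite bnd_simp.
- exact: integrable_from.
Qed.

Lemma partial_integralB_bounds (x y m M : R) : n0%:R <= x -> x <= y ->
  (forall t, t \in `[x, y] -> m <= f t <= M) ->
  m * (y - x) <= partial_integral n0 f y - partial_integral n0 f x <= M * (y - x).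
Proof.
move=> n0x xy fb; rewrite partial_integralB//.
have cstE (c : R) : c * (y - x) = \int[lebesgue_measure]_(t in `[x, y]) c.
  rewrite Rintegral_cst// (_ : y - x = fine (y - x)%:E)//; congr (c * fine _).
  have := lebesgue_measure_itv `[x, y]; rewrite /= lte_fin -EFinB => ->.
  by case: ltgtP xy => //= -> _; rewrite subrr.
have cstI (c : R) : lebesgue_measure.-integrable `[x, y] (EFin \o (fun=> c : R)).
  apply: continuous_compact_integrable; first exact: segment_compact.
  by apply: continuous_subspaceT => t; apply: cvg_cst.
rewrite !cstE; apply/andP; split; apply: le_Rintegral => //;
  try exact: integrable_from; by move=> t /fb/andP[].
Qed.

Hypothesis f_ge0 : forall x, x \in `[n0%:R, +oo[ -> 0 <= f x.

Lemma partial_integral_nondecreasing :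
  {homo partial_integral n0 f : x y / x <= y}.
Proof.
move=> x y xy; have [n0x|n0x] := leP n0%:R x.
  rewrite -subr_ge0 partial_integralB//; apply: Rintegral_ge0 => t /=.
  by rewrite in_itv/= => /andP[xt _]; rewrite f_ge0// in_itv/= (le_trans n0x).
(* For [x] below [n0] the domain is empty and the integral is [0]. *)
rewrite {1}/partial_integral set_itv_ge ?bnd_simp -?ltNge// Rintegral_set0.
by apply: Rintegral_ge0 => t /=; rewrite in_itv/= => /andP[n0t _];
  rewrite f_ge0// in_itv/= n0t.
Qed.

(** By monotonicity, the integral up to a real [x] is at most its value at an integer above [x], so
    the limit along the integers bounds it everywhere. *)
Lemma integral_convergesP : integral_converges n0 f <->
  cvgn (fun n => partial_integral n0 f n%:R).
Proof.
split=> [If|If].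
  apply: (@cvgP _ _ (lim (partial_integral n0 f x @[x --> +oo]))).
  exact: (@cvg_comp _ _ _ (fun n : nat => n%:R : R) _ _ _ _ cvgr_idn If).
have I_mono : {homo (fun n => partial_integral n0 f n%:R) : m n / (m <= n)%N >-> m <= n}.
  by move=> m n mn; apply: partial_integral_nondecreasing; rewrite ler_nat.
apply/cvg_ex; eexists; apply: nondecreasing_cvgr;
  first exact: partial_integral_nondecreasing.
exists (limn (fun n => partial_integral n0 f n%:R)) => _ [x _ <-].
apply: le_trans (nondecreasing_cvgn_le I_mono If (Num.truncn x).+1).
exact/partial_integral_nondecreasing/ltW/truncnS_gt.
Qed.

End PartialIntegral.

(** * Comparison of sums with integrals *)

Lemma nondecreasing_cvgn_dominated (R : realType) (u v : nat -> R) (N : nat) (c : R) :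
  {homo u : m n / (m <= n)%N >-> m <= n} -> {homo v : m n / (m <= n)%N >-> m <= n} ->
  (forall n, (N <= n)%N -> u n <= v n + c) -> cvgn v -> cvgn u.
Proof.
move=> u_mono v_mono uv v_cvg; apply: nondecreasing_is_cvgn => //.
exists (limn v + c) => _ [n _ <-].
apply: (le_trans (u_mono n (maxn N n) (leq_maxr _ _))).
by apply: (le_trans (uv _ (leq_maxl _ _))); rewrite lerD2r nondecreasing_cvgn_le.
Qed.

(** The integral test, extended to nondecreasing functions, for which both sides diverge. *)
Lemma cvgn_partial_sum_integral (R : realType) (n0 : nat) (a : nat -> R) (f : R -> R)
    (f_pos : forall x : R, x \in `[n0%:R, +oo[ -> 0 < f x)
    (f_cont : {within `[n0%:R, +oo[, continuous f})
    (f_mono : monotonic `[n0%:R, +oo[ f)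
    (f_thread : forall n : nat, (n0 <= n)%N -> f n%:R = a n) :
  cvgn (partial_sum n0 a) <-> cvgn (fun n => partial_integral n0 f n%:R).
Proof.
set I := fun n => partial_integral n0 f n%:R; set S := partial_sum n0 a.
have in_dom n : (n0 <= n)%N -> n%:R \in `[n0%:R : R, +oo[.
  by move=> n0n; rewrite in_itv/= andbT ler_nat.
have a_pos n : (n0 <= n)%N -> 0 < a n by move=> n0n; rewrite -f_thread// f_pos ?in_dom.
have f_ge0 x : x \in `[n0%:R, +oo[ -> 0 <= f x by move/f_pos/ltW.
have S_mono : {homo S : m n / (m <= n)%N >-> m <= n}.
  by apply: partial_sum_nondecreasing => n /a_pos/ltW.
have I_mono : {homo I : m n / (m <= n)%N >-> m <= n}.
  by move=> m n mn; apply: partial_integral_nondecreasing; rewrite ?ler_nat.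
have I_step n m M : (n0 <= n)%N -> (forall t, n%:R <= t <= n.+1%:R -> m <= f t <= M) ->
    m <= I n.+1 - I n <= M.
  move=> n0n fb.
  have := @partial_integralB_bounds R n0 f f_cont n%:R n.+1%:R m M.
  rewrite ler_nat ler_nat leqnSn n0n => /(_ isT isT).
  by rewrite -natrB// subSnn !mulr1; apply=> t; rewrite in_itv; exact: fb.
have I0 : I n0 = 0 by rewrite /I /partial_integral set_itv1 Rintegral_set1.
have S0 : S n0 = a n0 by exact: partial_sum_first.
have SS n : (n0 <= n)%N -> S n.+1 = S n + a n.+1 by exact: partial_sumS.
have in_step n t : (n0 <= n)%N -> n%:R <= t <= n.+1%:R -> t \in `[n0%:R : R, +oo[.
  by move=> n0n /andP[nt _]; rewrite in_itv/= andbT (le_trans _ nt) ?ler_nat.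
case: f_mono => f_mono.
  have {}I_step n : (n0 <= n)%N -> a n <= I n.+1 - I n <= a n.+1.
    move=> n0n; rewrite -!f_thread ?leqW//; apply: I_step => // t nt.
    have [nt1 nt2] := andP nt.
    by rewrite !f_mono ?in_dom ?leqW ?(in_step n).
  (* In the nondecreasing case each unit step adds at least [a n0 > 0], so the integral grows at
     least linearly. *)
  have I_ge n : (n0 <= n)%N -> (n - n0)%:R * a n0 <= I n.
    move=> /subnKC <-; elim: (n - n0)%N => [|k IH].
      by rewrite addn0 subnn mul0r I0.
    have /I_step/andP[Ik _] : (n0 <= n0 + k)%N by exact: leq_addr.
    have a_le : a n0 <= a (n0 + k)%N.
      by rewrite -!f_thread ?leq_addr// f_mono ?in_dom ?leq_addr// ler_nat leq_addr.
    move: IH; rewrite !addnS !addKn subSn ?leq_addr// addKn -natr1 mulrDl mul1r.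
    lra.
  have I_le n : (n0 <= n)%N -> I n <= S n + 0.
    move=> /subnKC <-; elim: (n - n0)%N => [|k IH].
      by rewrite addn0 addr0 I0 S0 ltW ?a_pos.
    rewrite addnS SS ?leq_addr//.
    have /I_step/andP[_] : (n0 <= n0 + k)%N by exact: leq_addr.
    lra.
  have nI : ~ cvgn I.
    (* By the Archimedean property, [k] satisfies [k * a n0 > l], whereas [I (n0 + k)] cannot exceed
       the limit [l]. *)
    move=> I_cvg; set l := limn I; pose k := (Num.truncn (l / a n0)).+1.
    have := nondecreasing_cvgn_le I_mono I_cvg (n0 + k)%N.
    apply/negP; rewrite -ltNge; apply: lt_le_trans (I_ge _ (leq_addr _ _)).
    by rewrite addKn -ltr_pdivrMr ?a_pos// truncnS_gt.
  split=> // S_cvg; case: nI; exact: nondecreasing_cvgn_dominated I_le S_cvg.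
have {}I_step n : (n0 <= n)%N -> a n.+1 <= I n.+1 - I n <= a n.
  move=> n0n; rewrite -!f_thread ?leqW//; apply: I_step => // t nt.
  have [nt1 nt2] := andP nt.
  by rewrite !f_mono ?in_dom ?leqW ?(in_step n).
(* In the nonincreasing case [S n] has one more term than there are unit intervals: comparison on
   the left endpoints leaves out [a n], on the right endpoints [a n0]. Keeping [a n] on the left
   makes the induction go through. *)
have bound n : (n0 <= n)%N -> I n + a n <= S n <= I n + a n0.
  move=> /subnKC <-; elim: (n - n0)%N => [|k IH].
    by rewrite addn0 I0 S0 add0r lexx.
  rewrite addnS SS ?leq_addr//.
  have /I_step : (n0 <= n0 + k)%N by exact: leq_addr.
  lra.
split.
  apply: (@nondecreasing_cvgn_dominated _ _ _ n0 0) => // n n0n.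
  have := bound n n0n; have := a_pos n n0n; lra.
apply: (@nondecreasing_cvgn_dominated _ _ _ n0 (a n0)) => // n /bound/andP[_]; exact.
Qed.

Theorem theorem1p15 (R : realType) (G : infinity_field R) (n0 : nat)
    (a : nat -> R) (f : R -> R)
    (a_pos : forall n : nat, (n0 <= n)%N -> 0 < a n)
    (a_mono : monotonic [pred n : nat | (n0 <= n)%N] a)
    (f_pos : forall x : R, x \in `[n0%:R, +oo[ -> 0 < f x)
    (f_cont : {within `[n0%:R, +oo[, continuous f})
    (f_mono : monotonic `[n0%:R, +oo[ f)
    (f_thread : forall n : nat, (n0 <= n)%N -> f n%:R = a n) :
  realize (sum_at_infty G n0 a) = realize (integral_at_infty G n0 f) /\
  ([/\ realize (sum_at_infty G n0 a) = 0%E,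
       realize (integral_at_infty G n0 f) = 0%E,
       sum_converges n0 a & integral_converges n0 f] \/
   [/\ realize (sum_at_infty G n0 a) = +oo%E,
       realize (integral_at_infty G n0 f) = +oo%E,
       ~ sum_converges n0 a & ~ integral_converges n0 f]).
Proof.
have f_ge0 x : x \in `[n0%:R, +oo[ -> 0 <= f x by move/f_pos/ltW.
have S_mono : {homo partial_sum n0 a : m n / (m <= n)%N >-> m <= n}.
  by apply: partial_sum_nondecreasing => n /a_pos/ltW.
have I_mono : {homo (fun n => partial_integral n0 f n%:R) :
    m n / (m <= n)%N >-> m <= n}.
  by move=> m n mn; apply: partial_integral_nondecreasing; rewrite ?ler_nat.
have SI := cvgn_partial_sum_integral _ _ _ _ f_pos f_cont f_mono f_thread.
have IP := integral_convergesP _ _ f_cont f_ge0.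
have [S_cvg|S_dvg] := pselect (sum_converges n0 a).
  have I_cvg := SI.1 S_cvg.
  have S0 : realize (sum_at_infty G n0 a) = 0%E by exact: realize_cvg.
  have I0 : realize (integral_at_infty G n0 f) = 0%E by exact: realize_cvg.
  by rewrite S0 I0; split=> //; left; split=> //; exact/IP.
(* A nondecreasing sequence that does not converge tends to [+oo], so [realize_dvg] applies to both
   sides. *)
have I_dvg := contra_not SI.2 S_dvg.
have Soo : realize (sum_at_infty G n0 a) = +oo%E.
  exact/realize_dvg/nondecreasing_dvgn_lt.
have Ioo : realize (integral_at_infty G n0 f) = +oo%E.
  exact/realize_dvg/nondecreasing_dvgn_lt.
by rewrite Soo Ioo; split=> //; right; split=> // /IP.
Qed.
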